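(* Let $X$ be a compact Hausdorff space, let $\sigma\colon X\to X$ be continuous and onto, and let $\tau\colon X\to X$ be continuous with $\sigma\circ\tau=\mathrm{id}_X$. Then the assignment $$S\bigl((\varphi,\mu)\bigr):=(\varphi\circ\sigma,\ \mu\circ\tau^{-1})$$ is well defined on equivalence classes and defines an isometry $S\colon\mathcal{H}(X)\to\mathcal{H}(X)$ (a linear norm-preserving operator).
   Context: Definition of $\mathcal{H}(X)$, for a compact Hausdorff space $X$. Its elements are equivalence classes of pairs $(\varphi,\mu)$, where $\varphi$ is a complex-valued Borel function on $X$, $\mu$ is a finite positive Borel measure on $X$, and $\int_X|\varphi|^2\,d\mu<\infty$. Two pairs are equivalent, $(\varphi,\mu)\sim(\psi,\nu)$, if there is a finite positive Borel measure $\lambda$ on $X$ with $\mu\ll\lambda$, $\nu\ll\lambda$ and $\varphi\sqrt{d\mu/d\lambda}=\psi\sqrt{d\nu/d\lambda}$ $\lambda$-a.e. The class of $(\varphi,\mu)$ is written $\varphi\sqrt{d\mu}$, or again $(\varphi,\mu)$. Operations: $(\varphi,\mu)+(\psi,\nu)=\bigl(\varphi\sqrt{d\mu/d\lambda}+\psi\sqrt{d\nu/d\lambda},\,\lambda\bigr)$ and $c(\varphi,\mu)=(c\varphi,\mu)$; inner product $\langle(\varphi,\mu)\mid(\psi,\nu)\rangle=\int_X\bar\varphi\,\psi\sqrt{d\mu/d\lambda}\sqrt{d\nu/d\lambda}\,d\lambda$, for any $\lambda$ with $\mu\ll\lambda$, $\nu\ll\lambda$ (e.g. $\lambda=\mu+\nu$).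 These are well defined on classes and $\mathcal{H}(X)$ is a complex Hilbert space, with $\|(\varphi,\mu)\|^2=\int_X|\varphi|^2\,d\mu$. For a map $\tau\colon X\to X$, $\mu\circ\tau^{-1}(E):=\mu(\tau^{-1}(E))$ for Borel $E\subset X$, where $\tau^{-1}(E)=\{x\in X: \tau(x)\in E\}$. *)

(* Defs.v *)
From HB Require Import structures.
From mathcomp Require Import all_boot all_order all_algebra generic_quotient.
From mathcomp Require Import all_classical all_reals all_analysis measurable_realfun.
From mathcomp Require Import complex ring lra.

Set Implicit Arguments.
Unset Strict Implicit.
Unset Printing Implicit Defensive.

Import Order.TTheory GRing.Theory Num.Theory.
Import numFieldTopology.Exports numFieldNormedType.Exports.
Local Open Scope classical_set_scope.
Local Open Scope ring_scope.
Local Open Scope complex_scope.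
Local Open Scope quotient_scope.

Local Notation Re := complex.Re.
Local Notation Im := complex.Im.

Notation Borel X := (g_sigma_algebraType (@open X)).

(* [R[i]^o] carries the metric topology of the complex plane. *)
Definition borel_fun (R : realType) (X : ptopologicalType) (f : X -> R[i]) :=
  measurable_fun [set: Borel X] (f : Borel X -> Borel R[i]^o).

Section complex_measurability.
Context {R : realType}.

Lemma normci : `|'i : R[i]| = 1.
Proof. by rewrite normc_def /= expr0n /= add0r expr1n sqrtr1. Qed.

Lemma norm_realC (x : R) : `|x%:C| = `|x|%:C.
Proof. by rewrite normc_def /= expr0n /= addr0 sqrtr_sqr. Qed.

Lemma norm_Im_le (z : R[i]) : `|Im z|%:C <= `|z|.
Proof.
rewrite -normrN -ReiNIm; apply: le_trans (normc_ge_Re _) _.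
by rewrite normrM normci mulr1.
Qed.

Lemma continuous_Re : continuous (@Re R : R[i]^o -> R).
Proof.
move=> z A /nbhs_ballP[e /= e0 eA].
apply/(@nbhs_ballP R[i] R[i]^o); exists e%:C => /=; first by rewrite ltcR.
move=> w; rewrite /ball /= => zw; apply: eA; rewrite /ball /= -ltcR.
apply: le_lt_trans zw.
by rewrite -raddfB; exact: normc_ge_Re.
Qed.

Lemma continuous_Im : continuous (@Im R : R[i]^o -> R).
Proof.
move=> z A /nbhs_ballP[e /= e0 eA].
apply/(@nbhs_ballP R[i] R[i]^o); exists e%:C => /=; first by rewrite ltcR.
move=> w; rewrite /ball /= => zw; apply: eA; rewrite /ball /= -ltcR.
apply: le_lt_trans zw.
by rewrite -raddfB; exact: norm_Im_le.
Qed.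

Lemma measurable_fun_continuousC (X : ptopologicalType) (f : X -> R[i])
    (g : R[i]^o -> R) :
  continuous g -> borel_fun f ->
  measurable_fun [set: Borel X] (g \o f : Borel X -> R).
Proof.
move=> cg mf; apply: (measurability _ (RGenOpens.measurableE R)).
move=> _ [_ [a [b ->] <-]]; rewrite setTI comp_preimage -[X in measurable X]setTI.
apply: mf => //; apply: sub_sigma_algebra.
by move/continuousP : cg; apply; exact: interval_open.
Qed.

Lemma borel_funP (X : ptopologicalType) (f : X -> R[i]) :
  borel_fun f <->
  measurable_fun [set: Borel X] ((fun x => Re (f x)) : Borel X -> R) /\
  measurable_fun [set: Borel X] ((fun x => Im (f x)) : Borel X -> R).
Proof.
split=> [mf|[mRe mIm]].
  by split; apply: (measurable_fun_continuousC _ mf);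
    [exact: continuous_Re|exact: continuous_Im].
apply: (@measurability _ _ (Borel X) (Borel R[i]^o) setT f (@open R[i]^o) erefl) => _ [U oU <-]; rewrite setTI.
pose rect (q : (rat * rat) * (rat * rat)) : set R[i] :=
  [set z | ratr q.1.1 < Re z < ratr q.1.2 /\ ratr q.2.1 < Im z < ratr q.2.2].
pose F q : set (Borel X) := if `[< rect q `<=` U >] then f @^-1` rect q else set0.
have -> : f @^-1` U = \bigcup_q F q.
  apply/seteqP; split=> x /=; last first.
    by move=> [q _]; rewrite /F; case: asboolP => // qU; exact: qU.
  move=> Ufx; have := open_nbhs_nbhs (conj oU Ufx).
  move=> /(@nbhs_ballP R[i] R[i]^o) [e /= e0 eU].
  have ereal : e = (Re e)%:C.
    move: e0; rewrite ltcE /= => /andP[/eqP e1 _].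
    by apply/eqP; rewrite eq_complex /= e1 !eqxx.
  have e0' : 0 < Re e by rewrite -ltcR -ereal.
  pose d := Re e / 2.
  have d0 : 0 < d by rewrite divr_gt0.
  have lo (r : R) : r - d < r by rewrite ltrBlDr ltrDl.
  have hi (r : R) : r < r + d by rewrite ltrDl.
  have [a1] := rat_in_itvoo (lo (Re (f x))).
  rewrite in_itv /= => /andP[a1l a1r].
  have [b1] := rat_in_itvoo (hi (Re (f x))).
  rewrite in_itv /= => /andP[b1l b1r].
  have [a2] := rat_in_itvoo (lo (Im (f x))).
  rewrite in_itv /= => /andP[a2l a2r].
  have [b2] := rat_in_itvoo (hi (Im (f x))).
  rewrite in_itv /= => /andP[b2l b2r].
  exists ((a1, b1), (a2, b2)) => //; rewrite /F.
  case: asboolP => [_|]; first by split => /=; rewrite ?a1r ?b1l ?a2r ?b2l.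
  case=> w [/= /andP[h1 h2] /andP[h3 h4]]; apply: eU.
  rewrite /ball /= ereal.
  rewrite (_ : f x - w = (Re (f x - w))%:C + 'i * (Im (f x - w))%:C); last exact: complexE.
  apply: le_lt_trans (ler_normD _ _) _.
  rewrite normrM normci mul1r !norm_realC -rmorphD ltcR.
  rewrite (splitr (Re e)) -/d !raddfB/=.
  by apply: ltrD; rewrite ltr_norml; apply/andP; split; lra.
apply: countable_bigcupT_measurable; first exact: countableP.
move=> q; rewrite /F; case: asboolP => // _.
rewrite (_ : _ @^-1` _ =
    ((fun x => Re (f x)) @^-1` `]ratr q.1.1, ratr q.1.2[%classic) `&`
    ((fun x => Im (f x)) @^-1` `]ratr q.2.1, ratr q.2.2[%classic)); last first.
  by apply/seteqP; split=> x /=; rewrite !in_itv.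
apply: measurableI; rewrite -[X in measurable X]setTI.
  exact: mRe.
exact: mIm.
Qed.

End complex_measurability.

(* [measurableType]s are pointed, whence [X : ptopologicalType]. *)
Notation finmeas R X := {finite_measure set (Borel X) -> \bar R}.

Section radon_nikodym_derivative.
Context {R : realType} {X : ptopologicalType}.
Implicit Types mu nu la ka : finmeas R X.

(* [Radon_Nikodym_SigmaFinite.f mu la] is the library's everywhere finite,
   nonnegative version of the derivative of [mu] with respect to [la]; it is
   a junk value when [mu] is not absolutely continuous with respect to [la]. *)
Definition rn mu la (x : X) : R := fine (Radon_Nikodym_SigmaFinite.f mu la x).

Lemma rnE mu la x : mu `<< la ->
  (rn mu la x)%:E = Radon_Nikodym_SigmaFinite.f mu la x.
Proof. by move=> mula; rewrite fineK// Radon_Nikodym_SigmaFinite.f_fin_num. Qed.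

Lemma rn_ge0 mu la x : mu `<< la -> 0 <= rn mu la x.
Proof. by move=> ml; apply/fine_ge0/Radon_Nikodym_SigmaFinite.f_ge0. Qed.

Lemma measurable_rn mu la : mu `<< la ->
  measurable_fun [set: Borel X] (rn mu la : Borel X -> R).
Proof.
move=> ml; apply/measurable_EFinP.
rewrite (_ : _ \o _ = Radon_Nikodym_SigmaFinite.f mu la).
  exact: measurable_int (Radon_Nikodym_SigmaFinite.f_integrable ml).
by apply/funext => x; rewrite /= rnE.
Qed.

Lemma rn_integral mu la A : mu `<< la -> measurable A ->
  mu A = (\int[la]_(x in A) (rn mu la x)%:E)%E.
Proof.
move=> ml mA; rewrite (Radon_Nikodym_SigmaFinite.f_integral ml mA).
by apply: eq_integral => x _; rewrite rnE.
Qed.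

Lemma ge0_rn_change mu la (f : X -> R) : mu `<< la -> (forall x, 0 <= f x) ->
  measurable_fun [set: Borel X] (f : Borel X -> R) ->
  (\int[la]_x (f x * rn mu la x)%:E = \int[mu]_x (f x)%:E)%E.
Proof.
move=> ml f0 mf.
rewrite -(@Radon_Nikodym_SigmaFinite.change_of_variables _ _ _ mu la)//.
- by apply: eq_integral => x _; rewrite EFinM rnE.
- exact/measurable_EFinP.
Qed.

Lemma rn_chain mu la ka : mu `<< la -> la `<< ka ->
  {ae ka, forall x : Borel X, rn mu ka x = rn mu la x * rn la ka x}.
Proof.
move=> ml lk.
have := @Radon_Nikodym_SigmaFinite.chain_rule _ _ _ mu ka la setT ml lk measurableT.
apply: filterS => x /(_ I) /= e.
by apply: EFin_inj; rewrite EFinM !rnE//; exact: null_dominates_trans lk.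
Qed.

Lemma ae_rn_eq0 la ka (P : Borel X -> Prop) : la `<< ka ->
  {ae la, forall x : Borel X, P x} -> {ae ka, forall x, rn la ka x = 0 \/ P x}.
Proof.
move=> lk [N [mN N0 PN]].
have mr : measurable_fun N (EFin \o (rn la ka : Borel X -> R)).
  by apply: measurable_funTS; apply/measurable_EFinP; exact: measurable_rn.
have : (\int[ka]_(x in N) `|(rn la ka x)%:E|)%E = 0.
  rewrite -N0 (rn_integral lk mN); apply: eq_integral => x _.
  by rewrite gee0_abs// lee_fin rn_ge0.
move=> /(ae_eq_integral_abs ka mN mr); apply: filterS => x /= h.
have [Px|nPx] := pselect (P x); first by right.
by left; apply: EFin_inj; apply: h; exact: PN.
Qed.

Lemma ae_rn_neq0 la ka : la `<< ka -> {ae la, forall x : Borel X, rn la ka x != 0}.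
Proof.
move=> lk; exists [set x | rn la ka x = 0].
have mZ : measurable ([set x | rn la ka x = 0] : set (Borel X)).
  have := measurable_rn lk measurableT (measurable_set1 (0 : R)).
  by rewrite setTI.
split => //; last by move=> x /= /negP; rewrite negbK => /eqP.
by rewrite (rn_integral lk mZ) integral0_eq// => x /= ->.
Qed.

Lemma null_dominates_ae mu la (P : Borel X -> Prop) : mu `<< la ->
  {ae la, forall x : Borel X, P x} -> {ae mu, forall x, P x}.
Proof.
move=> /null_content_dominatesP ml [N [mN N0 PN]].
by exists N; split => //; exact: ml.
Qed.

Lemma finmeas_add_fin mu nu : fin_num_fun (measure_add mu nu).
Proof.
by move=> A mA; rewrite measure_addE fin_numD !fin_num_measure.
Qed.

Definition finmeas_add_def mu nu : set (Borel X) -> \bar R := measure_add mu nu.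
HB.instance Definition _ mu nu := Measure.on (finmeas_add_def mu nu).
HB.instance Definition _ mu nu := Measure_isFinite.Build _ _ _
  (finmeas_add_def mu nu) (finmeas_add_fin mu nu).
Definition finmeas_add mu nu : finmeas R X := finmeas_add_def mu nu.

Lemma dominates_addl mu nu : mu `<< finmeas_add mu nu.
Proof.
apply/null_content_dominatesP => A mA.
rewrite /finmeas_add /= /finmeas_add_def measure_addE => /eqP.
by rewrite padde_eq0 ?measure_ge0// => /andP[/eqP].
Qed.

Lemma dominates_addr mu nu : nu `<< finmeas_add mu nu.
Proof.
apply/null_content_dominatesP => A mA.
rewrite /finmeas_add /= /finmeas_add_def measure_addE => /eqP.
by rewrite padde_eq0 ?measure_ge0// => /andP[_ /eqP].
Qed.

Definition finmeas0_def : set (Borel X) -> \bar R := mzero.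
HB.instance Definition _ := Measure.on finmeas0_def.
Lemma finmeas0_fin : fin_num_fun finmeas0_def. Proof. by []. Qed.
HB.instance Definition _ := Measure_isFinite.Build _ _ _
  finmeas0_def finmeas0_fin.
Definition finmeas0 : finmeas R X := finmeas0_def.

Lemma dominates_finmeas0 mu : finmeas0 `<< mu.
Proof. by apply/null_content_dominatesP. Qed.

End radon_nikodym_derivative.

Arguments dominates_addl {R X} mu nu.
Arguments dominates_addr {R X} mu nu.
Arguments dominates_finmeas0 {R X} mu.

Section borel_fun_operations.
Context {R : realType} {X : ptopologicalType}.
Implicit Types f g : X -> R[i].

Lemma borel_funD f g : borel_fun f -> borel_fun g -> borel_fun (f \+ g).
Proof.
move=> /borel_funP[fR fI] /borel_funP[gR gI]; apply/borel_funP; split.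
- rewrite (_ : (fun x => _) = (fun x => Re (f x)) \+ (fun x => Re (g x))).
    exact: measurable_funD.
  by apply/funext => x /=; rewrite raddfD.
- rewrite (_ : (fun x => _) = (fun x => Im (f x)) \+ (fun x => Im (g x))).
    exact: measurable_funD.
  by apply/funext => x /=; rewrite raddfD.
Qed.

Lemma borel_funM f g : borel_fun f -> borel_fun g -> borel_fun (f \* g).
Proof.
move=> /borel_funP[fR fI] /borel_funP[gR gI]; apply/borel_funP; split.
- rewrite (_ : (fun x => _) = ((fun x => Re (f x)) \* (fun x => Re (g x))) \-
    ((fun x => Im (f x)) \* (fun x => Im (g x)))).
    by apply: measurable_funB; exact: measurable_funM.
  by apply/funext => x /=; case: (f x); case: (g x).
- rewrite (_ : (fun x => _) = ((fun x => Re (f x)) \* (fun x => Im (g x))) \+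
    ((fun x => Im (f x)) \* (fun x => Re (g x)))).
    by apply: measurable_funD; exact: measurable_funM.
  by apply/funext => x /=; case: (f x); case: (g x).
Qed.

Lemma borel_fun_real (f : X -> R) :
  measurable_fun [set: Borel X] (f : Borel X -> R) ->
  borel_fun (fun x => (f x)%:C).
Proof. by move=> mf; apply/borel_funP; split => //=; exact: measurable_cst. Qed.

Lemma borel_fun_cst (c : R[i]) : @borel_fun R X (fun=> c).
Proof. by apply/borel_funP; split => //=; exact: measurable_cst. Qed.

Lemma borel_fun_conj f : borel_fun f -> borel_fun (fun x => (f x)^*).
Proof.
move=> /borel_funP[fR fI]; apply/borel_funP; split.
- by rewrite (_ : (fun x => _) = (fun x => Re (f x)))//; apply/funext => x; case: (f x).
- rewrite (_ : (fun x => _) = \- (fun x => Im (f x))).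
    exact: measurable_funN.
  by apply/funext => x /=; case: (f x).
Qed.

Lemma sqr_normcE (z : R[i]) : Re (`|z| ^+ 2) = Re z ^+ 2 + Im z ^+ 2.
Proof. by rewrite -add_Re2_Im2. Qed.

Lemma sqr_normc_ge0 (z : R[i]) : 0 <= Re (`|z| ^+ 2).
Proof. by rewrite sqr_normcE addr_ge0// sqr_ge0. Qed.

Lemma sqr_normcM (z w : R[i]) :
  Re (`|z * w| ^+ 2) = Re (`|z| ^+ 2) * Re (`|w| ^+ 2).
Proof. by rewrite !sqr_normcE; case: z w => [a b] [c d] /=; ring. Qed.

Lemma sqr_normcD_le (z w : R[i]) :
  Re (`|z + w| ^+ 2) <= 2 * Re (`|z| ^+ 2) + 2 * Re (`|w| ^+ 2).
Proof.
rewrite !sqr_normcE; case: z w => [a b] [c d] /=.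
have := sqr_ge0 (a - c); have := sqr_ge0 (b - d); rewrite !sqrrB !sqrrD; lra.
Qed.

Lemma measurable_sqr_norm f : borel_fun f ->
  measurable_fun [set: Borel X] ((fun x => Re (`|f x| ^+ 2)) : Borel X -> R).
Proof.
move=> /borel_funP[fR fI].
rewrite (_ : (fun x => _) = (fun x => Re (f x) ^+ 2) \+ (fun x => Im (f x) ^+ 2)).
  by apply: measurable_funD; exact: measurable_funX.
by apply/funext => x; rewrite sqr_normcE.
Qed.

End borel_fun_operations.

Record L2pair (R : realType) (X : ptopologicalType) := MkL2pair {
  pfun : X -> R[i];
  pmeas : finmeas R X;
  pfun_borel : borel_fun pfun;
  pfun_sqint : (\int[pmeas]_x (Re (`|pfun x| ^+ 2))%:E < +oo)%E }.

HB.instance Definition _ (R : realType) (X : ptopologicalType) :=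
  gen_eqMixin (L2pair R X).
HB.instance Definition _ (R : realType) (X : ptopologicalType) :=
  gen_choiceMixin (L2pair R X).

Section L2pair_theory.
Context {R : realType} {X : ptopologicalType}.
Implicit Types (p q r : L2pair R X) (mu nu la ka : finmeas R X).

Definition sqrt_rn mu la (x : X) : R := Num.sqrt (rn mu la x).

Definition dens p la (x : X) : R[i] := pfun p x * (sqrt_rn (pmeas p) la x)%:C.

Definition L2equiv p q := exists la, [/\ pmeas p `<< la, pmeas q `<< la &
  {ae la, forall x : Borel X, dens p la x = dens q la x}].

Lemma dens_borel p la : pmeas p `<< la -> borel_fun (dens p la).
Proof.
move=> pl; apply: borel_funM; first exact: pfun_borel.
apply: borel_fun_real.
rewrite (_ : sqrt_rn _ _ = @Num.sqrt R \o rn (pmeas p) la)//.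
apply: measurableT_comp; last exact: measurable_rn.
by apply: continuous_measurable_fun; exact: sqrt_continuous.
Qed.

Lemma dens_sqint p la : pmeas p `<< la ->
  (\int[la]_x (Re (`|dens p la x| ^+ 2))%:E =
   \int[pmeas p]_x (Re (`|pfun p x| ^+ 2))%:E)%E.
Proof.
move=> pl; rewrite -(ge0_rn_change pl); last 2 first.
- by move=> x; exact: sqr_normc_ge0.
- by apply: measurable_sqr_norm; exact: pfun_borel.
apply: eq_integral => x _; rewrite sqr_normcM; congr (_ * _)%:E.
by rewrite sqr_normcE /= expr0n addr0 sqr_sqrtr// rn_ge0.
Qed.

Lemma dens_chain p la ka : pmeas p `<< la -> la `<< ka ->
  {ae ka, forall x : Borel X, dens p ka x = dens p la x * (sqrt_rn la ka x)%:C}.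
Proof.
move=> pl lk; move: (rn_chain pl lk); apply: filterS => x e.
by rewrite /dens /sqrt_rn e sqrtrM ?rn_ge0// rmorphM mulrA.
Qed.

Lemma dens_eq_up p q la ka : pmeas p `<< la -> pmeas q `<< la -> la `<< ka ->
  {ae la, forall x : Borel X, dens p la x = dens q la x} ->
  {ae ka, forall x : Borel X, dens p ka x = dens q ka x}.
Proof.
move=> pl ql lk /(ae_rn_eq0 lk).
move: (dens_chain pl lk) (dens_chain ql lk).
apply: filterS3 => x -> -> [e|-> //].
by rewrite /sqrt_rn e sqrtr0 !mulr0.
Qed.

Lemma dens_eq_down p q la ka : pmeas p `<< la -> pmeas q `<< la -> la `<< ka ->
  {ae ka, forall x : Borel X, dens p ka x = dens q ka x} ->
  {ae la, forall x : Borel X, dens p la x = dens q la x}.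
Proof.
move=> pl ql lk pq.
have h : {ae ka, forall x : Borel X, dens p la x * (sqrt_rn la ka x)%:C =
    dens q la x * (sqrt_rn la ka x)%:C}.
  move: (dens_chain pl lk) (dens_chain ql lk) pq.
  by apply: filterS3 => x <- <-.
move: (ae_rn_neq0 lk) (null_dominates_ae lk h).
apply: filterS2 => x rx; apply: mulIf.
rewrite fmorph_eq0 sqrtr_eq0 -ltNge lt_neqAle rn_ge0// andbT eq_sym.
exact: rx.
Qed.

Lemma L2equivP p q ka : pmeas p `<< ka -> pmeas q `<< ka ->
  L2equiv p q <-> {ae ka, forall x : Borel X, dens p ka x = dens q ka x}.
Proof.
move=> pk qk; split=> [[la [pl ql pq]]|pq]; last by exists ka.
have kk := dominates_addl ka la; have lk := dominates_addr ka la.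
by apply: (dens_eq_down pk qk kk); exact: (dens_eq_up pl ql lk).
Qed.

Lemma L2equiv_refl p : L2equiv p p.
Proof. by exists (pmeas p); split => //; exact: aeW. Qed.

Lemma L2equiv_sym p q : L2equiv p q -> L2equiv q p.
Proof.
by move=> [la [pl ql pq]]; exists la; split => //; move: pq; apply: filterS => x ->.
Qed.

Lemma L2equiv_trans p q r : L2equiv p q -> L2equiv q r -> L2equiv p r.
Proof.
pose ka := finmeas_add (finmeas_add (pmeas p) (pmeas q)) (pmeas r).
have pk : pmeas p `<< ka.
  by apply: (null_dominates_trans (dominates_addl (pmeas p) (pmeas q))); exact: dominates_addl.
have qk : pmeas q `<< ka.
  by apply: (null_dominates_trans (dominates_addr (pmeas p) (pmeas q))); exact: dominates_addl.
have rk : pmeas r `<< ka by exact: dominates_addr.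
move=> /(L2equivP pk qk) pq /(L2equivP qk rk) qr; apply/(L2equivP pk rk).
by move: pq qr; apply: filterS2 => x -> ->.
Qed.

Lemma pairD_borel p q :
  borel_fun (dens p (finmeas_add (pmeas p) (pmeas q)) \+
             dens q (finmeas_add (pmeas p) (pmeas q))).
Proof.
apply: borel_funD; apply: dens_borel; [exact: dominates_addl|exact: dominates_addr].
Qed.

Lemma pairD_sqint p q (la := finmeas_add (pmeas p) (pmeas q)) :
  (\int[la]_x (Re (`|(dens p la \+ dens q la) x| ^+ 2))%:E < +oo)%E.
Proof.
have pl : pmeas p `<< la by exact: dominates_addl.
have ql : pmeas q `<< la by exact: dominates_addr.
have mp := measurable_sqr_norm (dens_borel pl).
have mq := measurable_sqr_norm (dens_borel ql).
apply: (@le_lt_trans _ _ (\int[la]_x (2%:E * (Re (`|dens p la x| ^+ 2))%:E +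
   2%:E * (Re (`|dens q la x| ^+ 2))%:E)))%E.
  apply: ge0_le_integral; first exact: measurableT.
  - by move=> x _; rewrite lee_fin sqr_normc_ge0.
  - by apply/measurable_EFinP; apply: measurable_sqr_norm; exact: pairD_borel.
  - by apply: emeasurable_funD; apply/measurable_EFinP; exact: measurable_funM.
  - by move=> x _; rewrite -!EFinM -EFinD lee_fin sqr_normcD_le.
rewrite ge0_integralD//.
- rewrite !ge0_integralZl//.
  + by rewrite !dens_sqint// lte_add_pinfty// lte_mul_pinfty// pfun_sqint.
  + exact/measurable_EFinP.
  + by move=> x _; rewrite lee_fin sqr_normc_ge0.
  + exact/measurable_EFinP.
  + by move=> x _; rewrite lee_fin sqr_normc_ge0.
- by move=> x _; rewrite -EFinM lee_fin mulr_ge0// sqr_normc_ge0.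
- by apply/measurable_EFinP; exact: measurable_funM.
- by move=> x _; rewrite -EFinM lee_fin mulr_ge0// sqr_normc_ge0.
- by apply/measurable_EFinP; exact: measurable_funM.
Qed.

Definition pairD p q : L2pair R X := MkL2pair (pairD_borel p q) (pairD_sqint p q).

Lemma pairZ_borel (c : R[i]) p : borel_fun (fun x => c * pfun p x).
Proof. by apply: borel_funM (borel_fun_cst c) (pfun_borel p). Qed.

Lemma pairZ_sqint (c : R[i]) p :
  (\int[pmeas p]_x (Re (`|c * pfun p x| ^+ 2))%:E < +oo)%E.
Proof.
rewrite (_ : integral _ _ _ =
    (Re (`|c| ^+ 2))%:E * \int[pmeas p]_x (Re (`|pfun p x| ^+ 2))%:E)%E.
  by rewrite lte_mul_pinfty ?pfun_sqint// lee_fin sqr_normc_ge0.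
rewrite -ge0_integralZl//.
- by apply: eq_integral => x _; rewrite sqr_normcM.
- by apply/measurable_EFinP; apply: measurable_sqr_norm; exact: pfun_borel.
- by move=> x _; rewrite lee_fin sqr_normc_ge0.
- by rewrite lee_fin sqr_normc_ge0.
Qed.

Definition pairZ (c : R[i]) p : L2pair R X :=
  MkL2pair (pairZ_borel c p) (pairZ_sqint c p).

Lemma pair0_sqint : (\int[@finmeas0 R X]_x (Re (`|(0 : R[i])| ^+ 2))%:E < +oo)%E.
Proof. by rewrite normr0 expr0n integral0. Qed.

Definition pair0 : L2pair R X := MkL2pair (borel_fun_cst 0) pair0_sqint.

Lemma densD p q ka : pmeas p `<< ka -> pmeas q `<< ka ->
  pmeas (pairD p q) `<< ka /\
  {ae ka, forall x : Borel X, dens (pairD p q) ka x = dens p ka x + dens q ka x}.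
Proof.
move=> pk qk; set la := finmeas_add (pmeas p) (pmeas q).
have lk : la `<< ka.
  apply/null_content_dominatesP => A mA kA.
  have -> : la A = (pmeas p A + pmeas q A)%E by exact: measure_addE.
  move/null_content_dominatesP : pk => /(_ _ mA kA) ->.
  by move/null_content_dominatesP : qk => /(_ _ mA kA) ->; rewrite adde0.
split => //; have pl : pmeas p `<< la by exact: dominates_addl.
have ql : pmeas q `<< la by exact: dominates_addr.
move: (dens_chain pl lk) (dens_chain ql lk); apply: filterS2 => x -> ->.
by rewrite /dens /= mulrDl.
Qed.

Lemma densZ c p ka x : dens (pairZ c p) ka x = c * dens p ka x.
Proof. by rewrite /dens /= mulrA. Qed.

Lemma dens0 ka x : dens pair0 ka x = 0.
Proof. by rewrite /dens /= mul0r. Qed.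

Definition inner_at la p q : R[i] :=
  let f x := (pfun p x)^* * pfun q x *
    (sqrt_rn (pmeas p) la x)%:C * (sqrt_rn (pmeas q) la x)%:C in
  Complex (Rintegral la setT (fun x => Re (f x)))
          (Rintegral la setT (fun x => Im (f x))).

Definition pair_inner p q := inner_at (finmeas_add (pmeas p) (pmeas q)) p q.

End L2pair_theory.

Section inner_product_invariance.
Context {R : realType} {X : ptopologicalType}.
Implicit Types (p q : L2pair R X) (mu la ka : finmeas R X).

Lemma rn_change mu la (f : X -> R) : mu `<< la ->
  mu.-integrable [set: Borel X] (EFin \o f) ->
  (\int[la]_x (f x * rn mu la x)%:E = \int[mu]_x (f x)%:E)%E.
Proof.
move=> ml fi; rewrite -(Radon_Nikodym_change_of_variables ml measurableT fi).
have mf := measurable_int _ fi.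
apply: ae_eq_integral => //.
- apply/measurable_EFinP; apply: measurable_funM; last exact: measurable_rn.
  exact/measurable_EFinP.
- by apply: emeasurable_funM => //; apply: measurable_int (Radon_Nikodym_integrable _).
- have := @ae_eq_Radon_Nikodym_SigmaFinite _ _ _ mu la ml setT measurableT.
  by apply: filterS => x /(_ I) e _; rewrite EFinM rnE// e.
Qed.

Lemma inner_integrand la p q x :
  (pfun p x)^* * pfun q x *
    (sqrt_rn (pmeas p) la x)%:C * (sqrt_rn (pmeas q) la x)%:C =
  (dens p la x)^* * dens q la x.
Proof.
rewrite /dens; case: (pfun p x) (pfun q x) => [a b] [c d].
by apply/eqP; rewrite eq_complex /=; apply/andP; split; apply/eqP; ring.
Qed.

Lemma inner_borel la p q : pmeas p `<< la -> pmeas q `<< la ->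
  borel_fun (fun x => (dens p la x)^* * dens q la x).
Proof.
by move=> pl ql; apply: borel_funM; [apply: borel_fun_conj|]; exact: dens_borel.
Qed.

Lemma inner_integrable (P : R[i] -> R) la p q :
  (forall z w, `|P (z^* * w)| <= Re (`|z| ^+ 2) + Re (`|w| ^+ 2)) ->
  pmeas p `<< la -> pmeas q `<< la ->
  measurable_fun [set: Borel X]
    ((fun x => P ((dens p la x)^* * dens q la x)) : Borel X -> R) ->
  la.-integrable [set: Borel X]
    (EFin \o (fun x => P ((dens p la x)^* * dens q la x))).
Proof.
move=> Ple pl ql mP.
have mp := measurable_sqr_norm (dens_borel pl).
have mq := measurable_sqr_norm (dens_borel ql).
apply/integrableP; split; first exact/measurable_EFinP.
apply: (@le_lt_trans _ _ (\int[la]_x ((Re (`|dens p la x| ^+ 2))%:E +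
   (Re (`|dens q la x| ^+ 2))%:E)))%E.
  apply: ge0_le_integral; first exact: measurableT.
  - by move=> x _; rewrite abse_ge0.
  - by apply: measurableT_comp => //; exact/measurable_EFinP.
  - by apply: emeasurable_funD; apply/measurable_EFinP.
  - by move=> x _; rewrite -EFinD lee_fin.
rewrite ge0_integralD//.
- by rewrite !dens_sqint// lte_add_pinfty// pfun_sqint.
- by move=> x _; rewrite lee_fin sqr_normc_ge0.
- exact/measurable_EFinP.
- by move=> x _; rewrite lee_fin sqr_normc_ge0.
- exact/measurable_EFinP.
Qed.

Lemma Re_conjM_le (z w : R[i]) :
  `|Re (z^* * w)| <= Re (`|z| ^+ 2) + Re (`|w| ^+ 2).
Proof.
rewrite !sqr_normcE; case: z w => [a b] [c d] /=.
have := (sqr_ge0 (a + c), sqr_ge0 (a - c), sqr_ge0 (b + d), sqr_ge0 (b - d)).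
have := (sqr_ge0 a, sqr_ge0 b, sqr_ge0 c, sqr_ge0 d).
rewrite !expr2 => -[[[]]] ? ? ? ? [[[]]] ? ? ? ?.
by rewrite ler_norml; apply/andP; split; nra.
Qed.

Lemma Im_conjM_le (z w : R[i]) :
  `|Im (z^* * w)| <= Re (`|z| ^+ 2) + Re (`|w| ^+ 2).
Proof.
rewrite !sqr_normcE; case: z w => [a b] [c d] /=.
have := (sqr_ge0 (a + d), sqr_ge0 (a - d), sqr_ge0 (b + c), sqr_ge0 (b - c)).
have := (sqr_ge0 a, sqr_ge0 b, sqr_ge0 c, sqr_ge0 d).
rewrite !expr2 => -[[[]]] ? ? ? ? [[[]]] ? ? ? ?.
by rewrite ler_norml; apply/andP; split; nra.
Qed.

Lemma inner_chain (P : R[i] -> R) la ka p q :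
  (forall z w, `|P (z^* * w)| <= Re (`|z| ^+ 2) + Re (`|w| ^+ 2)) ->
  (forall z r, P (z * r%:C) = P z * r) ->
  (forall f : X -> R[i], borel_fun f ->
     measurable_fun [set: Borel X] ((fun x => P (f x)) : Borel X -> R)) ->
  pmeas p `<< la -> pmeas q `<< la -> la `<< ka ->
  Rintegral ka setT (fun x => P ((dens p ka x)^* * dens q ka x)) =
  Rintegral la setT (fun x => P ((dens p la x)^* * dens q la x)).
Proof.
move=> Ple PZ mP pl ql lk; rewrite /Rintegral; congr fine.
have pk := null_dominates_trans pl lk; have qk := null_dominates_trans ql lk.
rewrite -(rn_change lk); last first.
  by apply: inner_integrable => //; apply: mP; exact: inner_borel.
apply: ae_eq_integral => //.
- by apply/measurable_EFinP; apply: mP; exact: inner_borel.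
- apply/measurable_EFinP; apply: measurable_funM; last exact: measurable_rn.
  by apply: mP; exact: inner_borel.
- move: (dens_chain pl lk) (dens_chain ql lk); apply: filterS2 => x -> -> _.
  congr EFin; rewrite -PZ; congr P.
  rewrite -[in RHS](@sqr_sqrtr _ (rn la ka x)) ?rn_ge0// -/(sqrt_rn la ka x).
  rewrite rmorphXn /=; move: (sqrt_rn la ka x) => s.
  case: (dens p la x) (dens q la x) => [a b] [c d].
  by apply/eqP; rewrite eq_complex /=; apply/andP; split; apply/eqP; ring.
Qed.

Lemma inner_at_chain la ka p q :
  pmeas p `<< la -> pmeas q `<< la -> la `<< ka ->
  inner_at ka p q = inner_at la p q.
Proof.
move=> pl ql lk; rewrite /inner_at; congr Complex.
- under eq_Rintegral do rewrite inner_integrand.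
  under [RHS]eq_Rintegral do rewrite inner_integrand.
  apply: inner_chain => //; first exact: Re_conjM_le.
  + by case=> a b r /=; ring.
  + by move=> f /borel_funP[].
- under eq_Rintegral do rewrite inner_integrand.
  under [RHS]eq_Rintegral do rewrite inner_integrand.
  apply: inner_chain => //; first exact: Im_conjM_le.
  + by case=> a b r /=; ring.
  + by move=> f /borel_funP[].
Qed.

Lemma inner_at_indep la ka p q :
  pmeas p `<< la -> pmeas q `<< la -> pmeas p `<< ka -> pmeas q `<< ka ->
  inner_at ka p q = inner_at la p q.
Proof.
move=> pl ql pk qk; rewrite -(inner_at_chain pl ql (dominates_addl la ka)).
by rewrite -(inner_at_chain pk qk (dominates_addr la ka)).
Qed.

Lemma inner_at_ae ka p q p' q' :
  pmeas p `<< ka -> pmeas q `<< ka -> pmeas p' `<< ka -> pmeas q' `<< ka ->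
  L2equiv p p' -> L2equiv q q' -> inner_at ka p q = inner_at ka p' q'.
Proof.
move=> pk qk p'k q'k /(L2equivP pk p'k) pp' /(L2equivP qk q'k) qq'.
have /borel_funP[mR mI] := inner_borel pk qk.
have /borel_funP[mR' mI'] := inner_borel p'k q'k.
rewrite /inner_at; congr Complex; rewrite /Rintegral; congr fine.
- apply: ae_eq_integral => //.
  + apply/measurable_EFinP; under eq_fun do rewrite inner_integrand; exact: mR.
  + apply/measurable_EFinP; under eq_fun do rewrite inner_integrand; exact: mR'.
  + by move: pp' qq'; apply: filterS2 => x e1 e2 _; rewrite !inner_integrand e1 e2.
- apply: ae_eq_integral => //.
  + apply/measurable_EFinP; under eq_fun do rewrite inner_integrand; exact: mI.
  + apply/measurable_EFinP; under eq_fun do rewrite inner_integrand; exact: mI'.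
  + by move: pp' qq'; apply: filterS2 => x e1 e2 _; rewrite !inner_integrand e1 e2.
Qed.

End inner_product_invariance.

Section Hspace.
Context {R : realType} {X : ptopologicalType}.
Implicit Types (p q r : L2pair R X) (la ka : finmeas R X).

Definition L2equivb p q : bool := `[< L2equiv p q >].

Lemma L2equivb_refl : reflexive L2equivb.
Proof. by move=> p; apply/asboolP; exact: L2equiv_refl. Qed.

Lemma L2equivb_sym : symmetric L2equivb.
Proof. by move=> p q; apply/asboolP/asboolP; exact: L2equiv_sym. Qed.

Lemma L2equivb_trans : transitive L2equivb.
Proof.
by move=> q p r /asboolP pq /asboolP qr; apply/asboolP/(L2equiv_trans pq qr).
Qed.

Canonical L2equiv_rel := EquivRel L2equivb L2equivb_refl L2equivb_sym L2equivb_trans.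

End Hspace.

Definition Hspace (R : realType) (X : ptopologicalType) :=
  {eq_quot (@L2equiv_rel R X)}.
HB.instance Definition _ R X := Choice.on (Hspace R X).
HB.instance Definition _ R X := EqQuotient.on (Hspace R X).

Section Hspace_structure.
Context {R : realType} {X : ptopologicalType}.
Implicit Types (p q r : L2pair R X) (la ka : finmeas R X).
Local Notation H := (Hspace R X).
Implicit Types u v w : H.

(* The class [\varphi \sqrt{d\mu}]. *)
Definition hclass p : H := \pi_H p.

Lemma hclassP p q : hclass p = hclass q <-> L2equiv p q.
Proof. by split=> [/eqmodP /asboolP|pq]; last exact/eqmodP/asboolP. Qed.

Lemma hclassK u : hclass (repr u) = u. Proof. exact: reprK. Qed.

Lemma repr_hclass p : L2equiv (repr (hclass p)) p.
Proof. by apply/hclassP; rewrite hclassK. Qed.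

(* Defined through representatives; [haddE], [hscaleE] and [hinnerE] below show
   that the choice is immaterial. *)
Definition hadd u v : H := hclass (pairD (repr u) (repr v)).
Definition hscale (c : R[i]) u : H := hclass (pairZ c (repr u)).
Definition hzero : H := hclass pair0.
Definition hopp u : H := hscale (-1) u.

Lemma hclass_common3 p q r : exists ka,
  [/\ pmeas p `<< ka, pmeas q `<< ka & pmeas r `<< ka].
Proof.
exists (finmeas_add (finmeas_add (pmeas p) (pmeas q)) (pmeas r)); split.
- have h1 := dominates_addl (pmeas p) (pmeas q).
  exact: (null_dominates_trans h1 (dominates_addl _ _)).
- have h1 := dominates_addr (pmeas p) (pmeas q).
  exact: (null_dominates_trans h1 (dominates_addl _ _)).
- exact: dominates_addr.
Qed.

Lemma hclassE ka p q : pmeas p `<< ka -> pmeas q `<< ka ->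
  {ae ka, forall x : Borel X, dens p ka x = dens q ka x} -> hclass p = hclass q.
Proof. by move=> pk qk pq; apply/hclassP; exists ka. Qed.

Lemma haddE p q : hadd (hclass p) (hclass q) = hclass (pairD p q).
Proof.
rewrite /hadd.
have [/hclassP ep /hclassP eq] := (repr_hclass p, repr_hclass q).
set p' := repr (hclass p) in ep *; set q' := repr (hclass q) in eq *.
have [k1 [pk1 qk1 p'k1]] := hclass_common3 p q p'.
pose ka := finmeas_add k1 (pmeas q').
have kk : k1 `<< ka by exact: dominates_addl.
have pk := null_dominates_trans pk1 kk; have qk := null_dominates_trans qk1 kk.
have p'k := null_dominates_trans p'k1 kk.
have q'k : pmeas q' `<< ka by exact: dominates_addr.
have [d1 e1] := densD p'k q'k; have [d2 e2] := densD pk qk.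
apply: (hclassE d1 d2).
have /(L2equivP p'k pk) ep' := proj1 (hclassP _ _) ep.
have /(L2equivP q'k qk) eq' := proj1 (hclassP _ _) eq.
have e3 : {ae ka, forall x : Borel X,
    dens p' ka x + dens q' ka x = dens p ka x + dens q ka x}.
  by move: ep' eq'; apply: filterS2 => x -> ->.
by move: e1 e2 e3; apply: filterS3 => x -> ->.
Qed.

Lemma hscaleE c p : hscale c (hclass p) = hclass (pairZ c p).
Proof.
rewrite /hscale; have [ka [pk p'k e]] := repr_hclass p.
apply: (@hclassE ka) => //.
by move: e; apply: filterS => x; rewrite !densZ => ->.
Qed.

Lemma haddA : associative hadd.
Proof.
move=> u v w; rewrite -(hclassK u) -(hclassK v) -(hclassK w).
move: (repr u) (repr v) (repr w) => p q r; rewrite !haddE.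
have [ka [pk qk rk]] := hclass_common3 p q r.
have [d1 e1] := densD qk rk; have [d2 e2] := densD pk d1.
have [d3 e3] := densD pk qk; have [d4 e4] := densD d3 rk.
apply: (hclassE d2 d4).
have f1 : {ae ka, forall x : Borel X, dens (pairD p (pairD q r)) ka x =
    dens p ka x + (dens q ka x + dens r ka x)}.
  by move: e1 e2; apply: filterS2 => x <-.
move: f1 e3 e4; apply: filterS3 => x -> + ->.
by move=> ->; rewrite addrA.
Qed.

Lemma haddC : commutative hadd.
Proof.
move=> u v; rewrite -(hclassK u) -(hclassK v).
move: (repr u) (repr v) => p q; rewrite !haddE.
have [ka [pk qk _]] := hclass_common3 p q q.
have [d1 e1] := densD pk qk; have [d2 e2] := densD qk pk.
apply: (hclassE d1 d2).
by move: e1 e2; apply: filterS2 => x -> ->; rewrite addrC.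
Qed.

Lemma hadd0 : left_id hzero hadd.
Proof.
move=> u; rewrite -(hclassK u); move: (repr u) => p; rewrite haddE.
have pk : pmeas p `<< pmeas p by [].
have [d1 e1] := densD (dominates_finmeas0 (pmeas p) : pmeas pair0 `<< _) pk.
apply: (hclassE d1 pk).
by move: e1; apply: filterS => x ->; rewrite dens0 add0r.
Qed.

Lemma haddN : left_inverse hzero hopp hadd.
Proof.
move=> u; rewrite -(hclassK u); move: (repr u) => p.
rewrite /hopp hscaleE haddE.
have pk : pmeas p `<< pmeas p by [].
have [d1 e1] := densD (pk : pmeas (pairZ (-1) p) `<< _) pk.
apply: (hclassE d1 (dominates_finmeas0 (pmeas p) : pmeas pair0 `<< _)).
by move: e1; apply: filterS => x ->; rewrite dens0 densZ mulN1r addNr.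
Qed.

HB.instance Definition _ := GRing.isZmodule.Build H haddA haddC hadd0 haddN.

Lemma hscaleA a b u : hscale a (hscale b u) = hscale (a * b) u.
Proof.
rewrite -(hclassK u); move: (repr u) => p; rewrite !hscaleE.
have pk : pmeas p `<< pmeas p by [].
apply: (@hclassE (pmeas p)) => //.
by apply: aeW => x; rewrite !densZ mulrA.
Qed.

Lemma hscale1 : left_id 1 hscale.
Proof.
move=> u; rewrite -[in RHS](hclassK u) /hscale.
apply: (@hclassE (pmeas (repr u))) => //.
by apply: aeW => x; rewrite densZ mul1r.
Qed.

Lemma hscaleDr : right_distributive hscale +%R.
Proof.
move=> a u v; change (hscale a (hadd u v) = hadd (hscale a u) (hscale a v)).
rewrite -(hclassK u) -(hclassK v).
move: (repr u) (repr v) => p q; rewrite !(haddE, hscaleE).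
have [ka [pk qk _]] := hclass_common3 p q q.
have [d1 e1] := densD pk qk.
have [d2 e2] := densD (pk : pmeas (pairZ a p) `<< ka) (qk : pmeas (pairZ a q) `<< ka).
apply: (hclassE (d1 : pmeas (pairZ a (pairD p q)) `<< ka) d2).
by move: e1 e2; apply: filterS2 => x + ->; rewrite !densZ => ->; rewrite mulrDr.
Qed.

Lemma hscaleDl v : {morph hscale^~ v : a b / a + b}.
Proof.
move=> a b; change (hscale (a + b) v = hadd (hscale a v) (hscale b v)).
rewrite -(hclassK v); move: (repr v) => p; rewrite !(haddE, hscaleE).
have pk : pmeas p `<< pmeas p by [].
have [d1 e1] := densD (pk : pmeas (pairZ a p) `<< _) (pk : pmeas (pairZ b p) `<< _).
apply: (hclassE (pk : pmeas (pairZ (a + b) p) `<< _) d1).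
by move: e1; apply: filterS => x ->; rewrite !densZ mulrDl.
Qed.

HB.instance Definition _ := GRing.Zmodule_isLmodule.Build R[i] H
  hscaleA hscale1 hscaleDr hscaleDl.

Definition hinner u v : R[i] := pair_inner (repr u) (repr v).

Lemma hinnerE la p q : pmeas p `<< la -> pmeas q `<< la ->
  hinner (hclass p) (hclass q) = inner_at la p q.
Proof.
move=> pl ql; rewrite /hinner /pair_inner.
have [ep eq] := (repr_hclass p, repr_hclass q).
set p' := repr (hclass p) in ep *; set q' := repr (hclass q) in eq *.
have [k1 [p'k1 q'k1 _]] := hclass_common3 p' q' q'.
pose ka := finmeas_add k1 la.
have kk : k1 `<< ka by exact: dominates_addl.
have lk : la `<< ka by exact: dominates_addr.
have p'k := null_dominates_trans p'k1 kk.
have q'k := null_dominates_trans q'k1 kk.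
rewrite (@inner_at_indep _ _ ka)//; last 2 first.
- exact: dominates_addl.
- exact: dominates_addr.
have pk := null_dominates_trans pl lk; have qk := null_dominates_trans ql lk.
by rewrite (inner_at_ae p'k q'k pk qk)// (inner_at_chain pl ql).
Qed.

Definition hnorm u : R := Num.sqrt (Re (hinner u u)).

Lemma sqr_hnormE p :
  hnorm (hclass p) ^+ 2 = Rintegral (pmeas p) setT (fun x => Re (`|pfun p x| ^+ 2)).
Proof.
have pp : pmeas p `<< pmeas p by [].
have e : Re (hinner (hclass p) (hclass p)) =
    Rintegral (pmeas p) setT (fun x => Re (`|pfun p x| ^+ 2)).
  rewrite (hinnerE pp pp) /inner_at /=.
  rewrite /Rintegral -[in RHS](dens_sqint pp); congr fine.
  apply: eq_integral => x _; rewrite inner_integrand sqr_normcE.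
  by congr EFin; case: (dens _ _ x) => a b /=; ring.
rewrite /hnorm sqr_sqrtr e// /Rintegral fine_ge0// integral_ge0// => x _.
by rewrite lee_fin sqr_normc_ge0.
Qed.

End Hspace_structure.

(* Main.v *)
(** The pushforward by [tau] carries a density back along its left inverse
    [sigma]: [d(mu o tau^-1)/d(la o tau^-1) = (dmu/dla) o sigma] almost
    everywhere, because integrating the right-hand side over [E] against
    [la o tau^-1] gives [mu (tau^-1 E)].  Hence [S] acts on densities as
    composition with [sigma], which respects sums, scalars and almost everywhere
    equalities, and the change of variables [tau] shows that it preserves norms. *)

From HB Require Import structures.
Require Import Defs.
From mathcomp Require Import all_boot all_order all_algebra.
From mathcomp Require Import all_classical all_reals all_analysis measurable_realfun.
From mathcomp Require Import complex.

Import numFieldTopology.Exports numFieldNormedType.Exports.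
Local Open Scope classical_set_scope.
Local Open Scope ring_scope.

Local Open Scope complex_scope.
Import Order.TTheory GRing.Theory Num.Theory.

Local Notation Re := complex.Re.
Local Notation Borel X := (g_sigma_algebraType (@open X)).

Lemma continuous_measurable_borel (X Y : ptopologicalType) (f : X -> Y) :
  continuous f -> measurable_fun [set: Borel X] (f : Borel X -> Borel Y).
Proof.
move=> /continuousP cf.
apply: (@measurability _ _ (Borel X) (Borel Y) setT f (@open Y) erefl) => _ [U oU <-].
by rewrite setTI; apply: sub_sigma_algebra; exact: cf.
Qed.

Section push_measure.
Context {R : realType} {X Y : ptopologicalType} {t : X -> Y}.
Hypothesis mt : measurable_fun [set: Borel X] (t : Borel X -> Borel Y).

Lemma measurable_preimage (A : set (Borel Y)) :
  measurable A -> measurable (t @^-1` A : set (Borel X)).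
Proof. by move=> mA; rewrite -[X in measurable X]setTI; exact: mt. Qed.

(* The unused binding makes [push_def] depend on [mt], so that instance
   resolution can recover the measurability proof from the term. *)
Definition push_def (mt' := mt) (mu : finmeas R X) : set (Borel Y) -> \bar R :=
  pushforward (mu : set (Borel X) -> \bar R) (t : Borel X -> Borel Y).

HB.instance Definition _ mu := Measure.copy (push_def mu)
  (measure_function_pushforward__canonical__measure_function_Measure mu mt).

Lemma push_fin (mu : finmeas R X) : fin_num_fun (push_def mu).
Proof. by move=> A mA; apply: fin_num_measure; exact: measurable_preimage. Qed.

HB.instance Definition _ mu := Measure_isFinite.Build _ _ _
  (push_def mu) (push_fin mu).

Definition push (mu : finmeas R X) : finmeas R Y := push_def mu.

End push_measure.

Section push_along_section.
Context {R : realType} {X Y : ptopologicalType} {t : X -> Y} {s : Y -> X}.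
Hypothesis mt : measurable_fun [set: Borel X] (t : Borel X -> Borel Y).
Hypothesis ms : measurable_fun [set: Borel Y] (s : Borel Y -> Borel X).
Hypothesis tK : cancel t s.
Implicit Types (mu la ka : finmeas R X) (p q : L2pair R X).

Lemma ge0_integral_push mu (E : set (Borel Y)) (f : X -> R) : measurable E ->
  (forall x, 0 <= f x) -> measurable_fun [set: Borel X] (f : Borel X -> R) ->
  (\int[push mt mu]_(y in E) (f (s y))%:E =
   \int[mu]_(x in t @^-1` E) (f x)%:E)%E.
Proof.
move=> mE f0 mf.
have mfs : measurable_fun [set: Borel Y] ((fun y => f (s y)) : Borel Y -> R).
  exact: (measurableT_comp mf ms).
rewrite [LHS](ge0_integral_pushforward mt)//; last 2 first.
- have /measurable_EFinP := mfs; exact: measurable_funTS.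
- by move=> y _; rewrite lee_fin.
by apply: eq_integral => x _ /=; rewrite tK.
Qed.

Lemma push_dominates mu la : mu `<< la -> push mt mu `<< push mt la.
Proof.
move=> /null_content_dominatesP ml; apply/null_content_dominatesP => A mA.
by apply: ml; exact: measurable_preimage.
Qed.

Lemma ae_push la (P : Borel X -> Prop) : {ae la, forall x : Borel X, P x} ->
  {ae push mt la, forall y : Borel Y, P (s y)}.
Proof.
move=> [N [mN N0 PN]]; exists (s @^-1` N); split.
- exact: measurable_preimage.
- rewrite -N0; congr (la _); apply/seteqP.
  by split=> x /=; rewrite /preimage /= tK.
- by move=> y /= ?; exact: PN.
Qed.

Lemma rn_push mu la : mu `<< la ->
  {ae push mt la, forall y : Borel Y,
    rn (push mt mu) (push mt la) y = rn mu la (s y)}.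
Proof.
move=> ml; have pml := push_dominates _ _ ml.
have mrn : measurable_fun [set: Borel Y] ((fun y => rn mu la (s y)) : Borel Y -> R).
  exact: (measurableT_comp (measurable_rn ml) ms).
have : ae_eq (push mt la) [set: Borel Y]
    (Radon_Nikodym_SigmaFinite.f (push mt mu) (push mt la))
    (fun y => (rn mu la (s y))%:E).
  apply: integral_ae_eq => //.
  - exact: Radon_Nikodym_SigmaFinite.f_integrable.
  - exact/measurable_EFinP.
  - move=> E _ mE; rewrite -Radon_Nikodym_SigmaFinite.f_integral//.
    rewrite ge0_integral_push//; last 2 first.
    + by move=> x; exact: rn_ge0.
    + exact: measurable_rn.
    by rewrite -rn_integral//; exact: measurable_preimage.
by apply: filterS => y /(_ I) e; apply: EFin_inj; rewrite rnE.
Qed.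

Lemma push_pair_borel p : borel_fun (fun y => pfun p (s y)).
Proof. exact: (measurableT_comp (pfun_borel p) ms). Qed.

Lemma push_pair_integral p :
  (\int[push mt (pmeas p)]_y (Re (`|pfun p (s y)| ^+ 2))%:E =
   \int[pmeas p]_x (Re (`|pfun p x| ^+ 2))%:E)%E.
Proof.
rewrite (ge0_integral_push _ _ (fun x => Re (`|pfun p x| ^+ 2)))//.
- by move=> x; exact: sqr_normc_ge0.
- by apply: measurable_sqr_norm; exact: pfun_borel.
Qed.

Lemma push_pair_sqint p :
  (\int[push mt (pmeas p)]_y (Re (`|pfun p (s y)| ^+ 2))%:E < +oo)%E.
Proof. by rewrite push_pair_integral; exact: pfun_sqint. Qed.

Definition push_pair p : L2pair R Y :=
  MkL2pair (push_pair_borel p) (push_pair_sqint p).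

Lemma dens_push p la : pmeas p `<< la ->
  {ae push mt la, forall y : Borel Y,
    dens (push_pair p) (push mt la) y = dens p la (s y)}.
Proof.
by move=> /rn_push; apply: filterS => y e; rewrite /dens /sqrt_rn /= e.
Qed.

Lemma push_pair_equiv p q : L2equiv p q -> L2equiv (push_pair p) (push_pair q).
Proof.
move=> [la [pl ql pq]]; exists (push mt la); split; try exact: push_dominates.
move: (dens_push _ _ pl) (dens_push _ _ ql) (ae_push _ _ pq).
by apply: filterS3 => y -> ->.
Qed.

Lemma push_pairD p q :
  L2equiv (push_pair (pairD p q)) (pairD (push_pair p) (push_pair q)).
Proof.
pose la := finmeas_add (pmeas p) (pmeas q).
have pl : pmeas p `<< la by exact: dominates_addl.
have ql : pmeas q `<< la by exact: dominates_addr.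
have [dl /ae_push e] := densD pl ql.
have [dl' e'] := densD (push_dominates _ _ pl : pmeas (push_pair p) `<< _)
  (push_dominates _ _ ql : pmeas (push_pair q) `<< _).
exists (push mt la); split => //.
have ed := dens_push _ _ dl.
have eq' : {ae push mt la, forall y : Borel Y,
    dens (pairD (push_pair p) (push_pair q)) (push mt la) y =
    dens p la (s y) + dens q la (s y)}.
  move: e' (dens_push _ _ pl) (dens_push _ _ ql).
  by apply: filterS3 => y -> -> ->.
by move: ed e eq'; apply: filterS3 => y -> -> ->.
Qed.

Lemma push_pairZ c p : push_pair (pairZ c p) = pairZ c (push_pair p).
Proof. by congr MkL2pair; exact: Prop_irrelevance. Qed.

Definition hpush (u : Hspace R X) : Hspace R Y := hclass (push_pair (repr u)).

Lemma hpushE p : hpush (hclass p) = hclass (push_pair p).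
Proof. by apply/hclassP/push_pair_equiv; exact: repr_hclass. Qed.

Lemma hpush_is_zmod_morphism : zmod_morphism hpush.
Proof.
have hpushD u v : hpush (u + v) = hpush u + hpush v.
  rewrite -(hclassK u) -(hclassK v); move: (repr u) (repr v) => p q.
  rewrite [hclass p + _]haddE !hpushE [RHS]haddE.
  exact/hclassP/push_pairD.
by move=> u v; apply/eqP; rewrite eq_sym subr_eq -hpushD subrK.
Qed.

Lemma hpush_is_scalable : scalable hpush.
Proof.
move=> c u; rewrite -(hclassK u); move: (repr u) => p.
by rewrite [c *: hclass p]hscaleE !hpushE [RHS]hscaleE push_pairZ.
Qed.

HB.instance Definition _ := GRing.isZmodMorphism.Build (Hspace R X) (Hspace R Y)
  hpush hpush_is_zmod_morphism.
HB.instance Definition _ := GRing.isScalable.Build R[i] (Hspace R X) (Hspace R Y)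
  *:%R hpush hpush_is_scalable.

Lemma hnorm_hpush u : hnorm (hpush u) = hnorm u.
Proof.
apply/eqP; rewrite -(@eqrXn2 _ 2) ?sqrtr_ge0//; apply/eqP.
rewrite -(hclassK u); move: (repr u) => p; rewrite hpushE !sqr_hnormE.
by rewrite /Rintegral push_pair_integral.
Qed.

End push_along_section.

Theorem lemma2p1 (R : realType) (X : ptopologicalType)
    (X_compact : compact [set: X]) (X_hausdorff : hausdorff_space X)
    (sigma tau : X -> X)
    (sigma_cont : continuous sigma) (sigma_onto : set_surj [set: X] [set: X] sigma)
    (tau_cont : continuous tau) (sigmaK : forall x : X, sigma (tau x) = x) :
  exists S0 : L2pair R X -> L2pair R X,
    [/\ (forall (p : L2pair R X) (x : X), pfun (S0 p) x = pfun p (sigma x)),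
        (forall (p : L2pair R X) (E : set (Borel X)), measurable E ->
           pmeas (S0 p) E = pmeas p (tau @^-1` E)),
        (forall p q : L2pair R X, L2equiv p q -> L2equiv (S0 p) (S0 q)) &
        exists S : {linear Hspace R X -> Hspace R X},
          (forall p : L2pair R X, S (hclass p) = hclass (S0 p)) /\
          (forall u : Hspace R X, hnorm (S u) = hnorm u)].
Proof.
have mt := continuous_measurable_borel _ _ _ tau_cont.
have ms := continuous_measurable_borel _ _ _ sigma_cont.
exists (push_pair mt ms sigmaK); split => //.
  by move=> p q; exact: push_pair_equiv.
exists (hpush mt ms sigmaK); split; first exact: hpushE.
exact: hnorm_hpush.
Qed.
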